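(* Let $\mathcal{H}$ be a Hilbert space, let $T \in \mathcal{B}(\mathcal{H})$ be a $C_{\cdot 0}$-contraction, and let $\mathcal{S}$ be a non-trivial closed subspace of $\mathcal{H}$. Then $\mathcal{S}$ is a $T$-invariant subspace of $\mathcal{H}$ (that is, $T\mathcal{S} \subseteq \mathcal{S}$) if and only if there exist a Hilbert space $\mathcal{D}$ and a bounded linear operator $\Pi : H^2_{\mathcal{D}}(\mathbb{D}) \to \mathcal{H}$ such that \[\Pi M_z = T \Pi \quad \text{and} \quad P_{\mathcal{S}} = \Pi \Pi^*.\]
   Context: All Hilbert spaces are separable and over $\mathbb{C}$. $\mathcal{B}(\mathcal{H})$ is the set of bounded linear operators on $\mathcal{H}$. A contraction $T$ on $\mathcal{H}$ (i.e. $\|Tf\| \le \|f\|$ for all $f \in \mathcal{H}$) is a $C_{\cdot 0}$-contraction if $T^{*m} \to 0$ as $m \to \infty$ in the strong operator topology. A non-trivial subspace is one different from $\{0\}$. $P_{\mathcal{S}}$ denotes the orthogonal projection of $\mathcal{H}$ onto $\mathcal{S}$. $\mathbb{D} = \{z \in \mathbb{C} : |z| < 1\}$; for a Hilbert space $\mathcal{D}$, $H^2_{\mathcal{D}}(\mathbb{D})$ is the $\mathcal{D}$-valued Hardy space over $\mathbb{D}$, i.e. the Hilbert space of functions $f(z) = \sum_{m \ge 0} a_m z^m$ with $a_m \in \mathcal{D}$ and $\|f\|^2 = \sum_{m\ge 0} \|a_m\|^2 < \infty$, and $M_z$ is the shift $(M_z f)(z) = z f(z)$ on it. *)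

(* Defs.v *)
From HB Require Import structures.
From mathcomp Require Import all_boot all_order all_algebra.
From mathcomp Require Import all_classical all_reals all_analysis.
From mathcomp Require Import complex ring.

Set Implicit Arguments.
Unset Strict Implicit.
Unset Printing Implicit Defensive.

Import Order.TTheory GRing.Theory Num.Theory.
Import numFieldNormedType.Exports.

Local Open Scope classical_set_scope.
Local Open Scope ring_scope.

(* The carrier of [Cplx R] is [R[i]]; keeping the constant folded lets the
   topology of an arbitrary numFieldType be inferred on it. *)
Definition Cplx (R : realType) : numClosedFieldType := R[i].
Arguments Cplx : simpl never.

(* {dot H for conjC}: linear in the first argument, conjugate-linear in the
   second, hermitian and positive definite. *)
HB.mixin Record isHilbert (R : realType) H
    & CompleteNormedModule (Cplx R) H := {
  hdot : {dot H for @Num.conj (Cplx R)};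
  hdot_norm : forall x : H, `|x| ^+ 2 = hdot x x }.

#[short(type="hilbertType")]
HB.structure Definition Hilbert (R : realType) :=
  {H of CompleteNormedModule (Cplx R) H & isHilbert R H}.

Notation "''[' x , y ]" := (hdot x y) (at level 0, format "''[' x ,  y ]").

Section operators.
Context {R : realType}.
Local Notation C := (Cplx R).

Definition separable_space (T : topologicalType) :=
  exists2 A : set T, countable A & dense A.

Definition bounded_op (H K : hilbertType R) (A : H -> K) :=
  exists M : C, forall x, `|A x| <= M * `|x|.

(* For a bounded linear [A] the vector [z] below exists and is unique for every
   [y], by the Riesz representation theorem. *)
Definition adjoint (H K : hilbertType R) (A : H -> K) (y : K) : H :=
  xget 0 [set z | forall x, '[A x, y] = '[x, z]].

(* For a closed subspace [S], the unique point of [S] such that [x - y] is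
   orthogonal to [S]. *)
Definition orthoproj (H : hilbertType R) (S : set H) (x : H) : H :=
  xget 0 [set y | S y /\ forall s, S s -> '[x - y, s] = 0].

Definition C_dot0_contraction (H : hilbertType R) (T : H -> H) :=
  (forall x, `|T x| <= `|x|) /\
  (forall x, (fun m => iter m (adjoint T) x) @ \oo --> (0 : H)).

Definition closed_subspace (H : hilbertType R) (S : set H) :=
  submod_closed [in S] /\ closed S.

End operators.

Section dot_theory.
Variables (C : numClosedFieldType) (U : lmodType C).
Variable form : {dot U for @Num.conj C}.

Lemma dot_CauchySchwarz u v :
  `|form u v| <= sqrtC (form u u) * sqrtC (form v v).
Proof.
have dge0 w : 0 <= form w w.
  have [->|w0] := eqVneq w 0; first by rewrite linear0l.
  exact/ltW/neq0_dnorm_gt0.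
have [->|v0] := eqVneq v 0; first by rewrite linear0r normr0 mulr_ge0 ?sqrtC_ge0.
have vgt0 : 0 < form v v by exact: neq0_dnorm_gt0.
rewrite -sqrtCM ?nnegrE// -(@ler_pXn2r _ 2) ?nnegrE ?sqrtC_ge0 ?mulr_ge0//.
rewrite sqrtCK normCK.
set a := form u v / form v v.
have ou : form (u - a *: v) v = 0.
  by rewrite linearBl/= linearZl_LR/= /a divfK ?subrr// gt_eqF.
have E : form u u = form (u - a *: v) (u - a *: v) + `|form u v| ^+ 2 / form v v.
  rewrite -{1 2}(subrK (a *: v) u) hnormDd; last first.
    by rewrite linearZr_LR/= ou mulr0.
  congr (_ + _); rewrite linearZl_LR linearZr_LR/= mulrA -normCK /a.
  rewrite normf_div exprMn exprVn (ger0_norm (dge0 v)) -mulrA; congr (_ * _).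
  by rewrite expr2 invfM -mulrA mulVf ?mulr1// gt_eqF.
by rewrite E mulrDl divfK ?gt_eqF// -normCK lerDr mulr_ge0.
Qed.

Lemma dot_ge0 u : 0 <= form u u.
Proof.
have [->|u0] := eqVneq u 0; first by rewrite linear0l.
exact/ltW/neq0_dnorm_gt0.
Qed.

Lemma dot_triangle u v :
  sqrtC (form (u + v) (u + v)) <= sqrtC (form u u) + sqrtC (form v v).
Proof.
rewrite -(@ler_pXn2r _ 2) ?nnegrE ?sqrtC_ge0 ?addr_ge0 ?dot_ge0 ?sqrtC_ge0 ?dot_ge0//.
rewrite sqrtCK sqrrD !sqrtCK hnormD /= expr0 mul1r addrAC lerD2r lerD2l.
have -> : form u v + (form u v)^* = 'Re (form u v) *+ 2.
  by rewrite -mulr_natr ReE divfK// pnatr_eq0.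
rewrite lerMn2r /=; apply: le_trans (dot_CauchySchwarz u v).
exact: (leif_Re_Creal _).1.
Qed.

End dot_theory.

Section complex_limits.
Variable C : numClosedFieldType.

Lemma dot_polarization (U : lmodType C) (form : {dot U for @Num.conj C}) u v :
  let q c := form (c *: v + u) (c *: v + u) in
  form u v = 4^-1 * q 1 + (- 4^-1 * q (-1) +
    ('i / 4 * q 'i + (- ('i / 4) * q (- 'i) + 0))).
Proof.
move=> q; have qE c : q c = c * c^* * form v v + form u u +
    (c * (form u v)^* + c^* * form u v).
  have E1 : form (c *: v) (c *: v) = c * c^* * form v v.
    by rewrite dnormZ normCK.
  have E2 : form (c *: v) u = c * (form u v)^*.
    by rewrite linearZl_LR/= (hermC form v u) expr0 mul1r.
  by rewrite /q hnormD/= E1 E2 expr0 mul1r rmorphM/= conjCK.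
rewrite !qE !rmorphN !rmorph1/= conjCi opprK addr0.
have ii : 'i * 'i = -1 :> C by rewrite -expr2 sqrCi.
set A := form v v; set B := form u u; set D := form u v; set E := D^*.
have -> : 4^-1 * (1 * 1 * A + B + (1 * E + 1 * D)) +
 (- 4^-1 * (-1 * -1 * A + B + (-1 * E + -1 * D)) +
  ('i / 4 * ('i * - 'i * A + B + ('i * E + - 'i * D)) +
   - ('i / 4) * (- 'i * 'i * A + B + (- 'i * E + 'i * D)))) =
  2 / 4 * (E + D) + 2 / 4 * ('i * 'i * (E - D)) by ring.
rewrite ii mulN1r opprB -mulrDr addrACA addrC.
by field.
Qed.

Lemma series0C : series (fun _ : nat => 0 : C) = fun=> 0.
Proof. by apply/funext => n; rewrite /series/= big1. Qed.

Lemma limC_ge0 (u : nat -> C) (l : C) :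
  u @ \oo --> l -> (forall n, 0 <= u n) -> 0 <= l.
Proof.
move=> ul u0; have E : (Num.norm \o u) = u.
  by apply/funext => n /=; rewrite ger0_norm.
have := cvg_norm ul; rewrite -/(Num.norm \o u) E => ul'.
by rewrite (cvg_unique _ ul (ul' _)).
Qed.

Lemma limC_le (u : nat -> C) (l M : C) :
  u @ \oo --> l -> (forall n, u n <= M) -> l <= M.
Proof.
move=> ul uM; rewrite -subr_ge0; apply: (@limC_ge0 (fun n => M - u n)).
  by apply: cvgB => //; exact: cvg_cst.
by move=> n; rewrite subr_ge0.
Qed.

Lemma nneg_seriesC_le (u : nat -> C) (l : C) :
  (forall n, 0 <= u n) -> series u @ \oo --> l -> forall n, series u n <= l.
Proof.
move=> u0 ul n; rewrite -subr_ge0.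
apply: (@limC_ge0 (fun k => series u (k + n)%N - series u n)).
  by apply: cvgB; [rewrite cvg_shiftn|exact: cvg_cst].
by move=> k; rewrite sub_series_geq ?leq_addl// sumr_ge0.
Qed.

Lemma limC_leB (u : nat -> C) (x M : C) :
  u @ \oo --> (0 : C) -> (forall n, x - u n <= M) -> x <= M.
Proof.
move=> u0; rewrite -{2}(subr0 x); apply: limC_le.
by apply: cvgB => //; exact: cvg_cst.
Qed.

Lemma cvg_shift_norm0 (V : normedModType C) (s : nat -> V) n :
  s @ \oo --> (0 : V) -> `|s (N + n)%N| @[N --> \oo] --> (0 : C).
Proof.
move=> s0; rewrite (@cvg_shiftn n _ (fun N => `|s N|)).
have := cvg_norm s0; rewrite normr0; exact.
Qed.

Lemma cvg_seriesZD (u v : nat -> C) (k l l' : C) :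
  series u @ \oo --> l -> series v @ \oo --> l' ->
  series (fun m => k * u m + v m) @ \oo --> k * l + l'.
Proof.
move=> ul vl.
have -> : series (fun m => k * u m + v m) = k *: series u + series v.
  apply/funext => n; rewrite /series/= !fctE scaler_sumr -big_split/=.
  exact: eq_bigr.
exact: (cvgD (cvgZr ul) vl).
Qed.

Lemma eq_cvg_seriesC (u v : nat -> C) (l : C) :
  (forall m, v m = u m) -> series u @ \oo --> l -> series v @ \oo --> l.
Proof. by move=> /funext ->. Qed.

Lemma limF_le (T : Type) (F : set_system T) {FF : ProperFilter F}
    (u : T -> C) (l M : C) :
  u @ F --> l -> (\forall x \near F, u x <= M) -> l <= M.
Proof.
move=> ul uM; rewrite -subr_ge0.
have Ml : (fun x => M - u x) @ F --> M - l.
  by apply: cvgB => //; exact: cvg_cst.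
have Ml' : (fun x => M - u x) @ F --> `|M - l|.
  apply: cvg_trans (cvg_norm Ml); apply: near_eq_cvg.
  by apply: filterS uM => x uxM; rewrite ger0_norm// subr_ge0.
by rewrite (cvg_unique _ Ml Ml').
Qed.

Lemma cvg_sum_sqnorm (T : Type) (F : set_system T) {FF : Filter F}
    (V : normedModType C) (g : nat -> T -> V) (a : nat -> V) N :
  (forall m, g m @ F --> a m) ->
  (fun x => \sum_(0 <= m < N) `|g m x| ^+ 2 : C) @ F -->
  (\sum_(0 <= m < N) `|a m| ^+ 2 : C).
Proof.
move=> ga; elim: N => [|N IH].
  by rewrite big_nil; under eq_fun do rewrite big_nil; exact: cvg_cst.
rewrite big_nat_recr//=; under eq_fun do rewrite big_nat_recr//=.
apply: cvgD IH _; rewrite expr2; under eq_fun do rewrite expr2.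
by apply: cvgM; exact: cvg_norm.
Qed.

Lemma is_cvg_seriesZD (u v : nat -> C) (k : C) :
  cvgn (series u) -> cvgn (series v) ->
  cvgn (series (fun m => k * u m + v m)).
Proof.
by move=> /cvg_ex[l ul] /cvg_ex[l' vl]; apply/cvg_ex; exists (k * l + l'); exact: cvg_seriesZD.
Qed.

Lemma cvg_series_conj (u : nat -> C) (l : C) :
  series u @ \oo --> l -> series (fun m => (u m)^*) @ \oo --> l^*.
Proof.
move=> /cvgrPdist_lt ul; apply/cvgrPdist_lt => e /ul; apply: filterS => n.
by rewrite /series/= -rmorph_sum -rmorphB norm_conjC.
Qed.

Lemma is_cvgC (u : nat -> C) : cvgn u -> u @ \oo --> limn u.
Proof. by []. Qed.

Lemma cvg_uniqueC (u : nat -> C) (l l' : C) : u @ \oo --> l -> u @ \oo --> l' -> l = l'.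
Proof. by move=> ul ul'; exact: (cvg_unique _ ul ul'). Qed.

Lemma normed_seriesC_cvg (V : completeNormedModType C) (u : nat -> V)
    (b : nat -> C) :
  (forall n, `|u n| <= b n) -> cvgn (series b) -> cvgn (series u).
Proof.
move=> ub /cvg_cauchy/cauchy_seriesP cb.
apply/cauchy_cvgP/cauchy_seriesP => e /cb.
apply: filterS => n; apply: le_lt_trans.
apply: (le_trans (ler_norm_sum _ _ _)).
apply: (@le_trans _ _ (\sum_(n.1 <= k < n.2) b k)); first exact: ler_sum.
by apply: real_ler_norm; apply: rpred_sum => k _; apply: ger0_real; exact: le_trans (ub k).
Qed.

End complex_limits.
Section mct.
Context {R : realType}.
Local Notation C := (Cplx R).

(* monotone convergence, transported from R *)
Lemma nneg_seriesC_cvg (u : nat -> C) (M : C) :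
  (forall n, 0 <= u n) -> (forall n, series u n <= M) -> cvgn (series u).
Proof.
move=> u0 uM.
pose toC (x : R) : C := (real_complex R x).
have uE n : u n = toC (complex.Re (u n)).
  by rewrite /toC RRe_real// ger0_real.
have sE n : series u n = toC (series (fun k => complex.Re (u k)) n).
  rewrite /series/= /toC raddf_sum/=; apply: eq_bigr => k _; exact: uE.
have : cvgn (series (fun k => complex.Re (u k))).
  apply: nondecreasing_is_cvgn.
    apply: nondecreasing_series => n _ _.
    by have := u0 n; rewrite uE /toC ler0c.
  exists (complex.Re M) => _ [n _ <-].
  have := uM n; rewrite sE => h.
  by move: h; rewrite /toC lecE => /andP[].
move=> /cvg_ex[l ul]; apply/cvg_ex; exists (toC l).
apply/cvgrPdist_lt => e e0.
have eE : e = toC (complex.Re e) by rewrite /toC RRe_real// ger0_real// ltW.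
have e0' : 0 < complex.Re e by move: e0; rewrite {1}eE /toC ltcR.
near=> n; rewrite sE eE /toC -raddfB/= normc_def /=.
rewrite expr0n addr0 sqrtr_sqr ltcR.
by near: n; move: e0'; move: (complex.Re e); apply/cvgrPdist_lt.
Unshelve. all: by end_near. Qed.

End mct.

Section hardy_coefficients.
Context {R : realType}.
Local Notation C := (Cplx R).

Definition disc := {z : C | `|z| < 1}.

Definition square_summable (D : hilbertType R) (a : nat -> D) :=
  cvgn (series (fun m => `|a m| ^+ 2 : C)).

Definition power_sum (D : hilbertType R) (a : nat -> D) (f : disc -> D) :=
  forall z : disc, series (fun m => val z ^+ m *: a m) @ \oo --> f z.

Variable D : hilbertType R.
Implicit Types (a b : nat -> D) (f g : disc -> D) (x K : C).

Lemma square_summable_le a (M : C) :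
  (forall n, \sum_(0 <= m < n) `|a m| ^+ 2 <= M) -> square_summable a.
Proof.
by move=> aM; apply: (nneg_seriesC_cvg (M := M)) => // n; exact: exprn_ge0.
Qed.

Lemma square_summable_ex_le a : square_summable a ->
  exists M : C, forall n, \sum_(0 <= m < n) `|a m| ^+ 2 <= M.
Proof.
move=> /cvg_ex[l al]; exists l; apply: (nneg_seriesC_le _ al) => n.
exact: exprn_ge0.
Qed.

Lemma square_summable_bounded a : square_summable a ->
  exists2 K : C, 0 <= K & forall m, `|a m| <= K.
Proof.
move=> /square_summable_ex_le[M aM].
have M0 : 0 <= M by have := aM 0%N; rewrite big_nil.
exists (sqrtC M) => [|m]; first by rewrite sqrtC_ge0.
rewrite -(@ler_pXn2r _ 2) ?nnegrE ?sqrtC_ge0// sqrtCK.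
apply: le_trans (aM m.+1); rewrite big_nat_recr//= lerDr sumr_ge0 //.
Qed.

Lemma square_summableZD (c : C) a b : square_summable a -> square_summable b ->
  square_summable (fun m => c *: a m + b m).
Proof.
move=> /square_summable_ex_le[M aM] /square_summable_ex_le[N bN].
apply: (@square_summable_le _ (2 * (`|c| ^+ 2 * M + N))) => n.
apply: (@le_trans _ _
    (\sum_(0 <= m < n) 2 * (`|c| ^+ 2 * `|a m| ^+ 2 + `|b m| ^+ 2))).
  apply: ler_sum => m _; rewrite -exprMn -normrZ.
  apply: (@le_trans _ _ ((`|c *: a m| + `|b m|) ^+ 2)).
    by rewrite ler_pXn2r ?nnegrE ?addr_ge0 ?normr_ge0 ?ler_normD.
  rewrite sqrrD mulr_natl mulr2n -subr_ge0.
  have -> (p q : C) : p ^+ 2 + q ^+ 2 + (p ^+ 2 + q ^+ 2) -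
      (p ^+ 2 + p * q *+ 2 + q ^+ 2) = (p - q) ^+ 2.
    by rewrite sqrrB; ring.
  by rewrite -realEsqr realB ?ger0_real ?normr_ge0.
rewrite -mulr_sumr ler_wpM2l ?ler0n// big_split/= -mulr_sumr lerD//.
by rewrite ler_wpM2l// exprn_ge0.
Qed.

Lemma geometric_le x K m n : 0 <= x < 1 -> 0 <= K ->
  \sum_(m <= k < n) x ^+ k * K <= x ^+ m * K / (1 - x).
Proof.
move=> /andP[x0 x1] K0.
rewrite ler_pdivlMr ?subr_gt0// -mulr_suml.
have [mn|/ltnW nm] := leqP m n; last first.
  by rewrite big_geq// !mul0r mulr_ge0// exprn_ge0.
suff -> : (\sum_(m <= k < n) x ^+ k) * K * (1 - x) = (x ^+ m - x ^+ n) * K.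
  by rewrite ler_wpM2r// gerBl exprn_ge0.
rewrite mulrAC mulr_suml; congr (_ * K).
rewrite (eq_bigr (fun k => - (x ^+ k.+1 - x ^+ k))).
  by rewrite sumrN telescope_sumr// opprB.
by move=> k _; rewrite opprB mulrBr mulr1 -exprSr.
Qed.

Lemma power_sum_cvg a : square_summable a ->
  exists f, power_sum a f.
Proof.
move=> /square_summable_bounded[K K0 aK].
have cz (z : disc) : cvgn (series (fun m => val z ^+ m *: a m)).
  have z01 : 0 <= `|val z| < 1 by rewrite normr_ge0 (valP z).
  apply: (@normed_seriesC_cvg C D _ (fun m => `|val z| ^+ m * K)).
    by move=> m; rewrite normrZ normrX ler_wpM2l// exprn_ge0.
  apply: nneg_seriesC_cvg => [m|n]; first by rewrite mulr_ge0// exprn_ge0.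
  exact: geometric_le.
by exists (fun z => limn (series (fun m => val z ^+ m *: a m))) => z; exact: cz.
Qed.

Lemma power_sum0 a : square_summable a -> power_sum a 0 -> forall m, a m = 0.
Proof.
move=> /square_summable_bounded[K K0 aK] a0.
elim/ltn_ind => n IH; apply/eqP; rewrite -normr_eq0; apply/eqP.
pose c := `|a n|; rewrite -/c.
have c0 : 0 <= c by exact: normr_ge0.
have [//|cn0] := eqVneq c 0.
have {cn0}c_gt0 : 0 < c by rewrite lt_def cn0.
exfalso.
have [t [t0 t1 tc]] : exists t : C, [/\ 0 < t, t <= 2^-1 & t * (K * 2) < c].
  have d0 : 0 < 2 * K + c by rewrite ltr_wpDl// mulr_ge0.
  have d1 : 0 < 2 * (2 * K + c) by rewrite mulr_gt0.
  exists (c / (2 * (2 * K + c))); split.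
  - by rewrite divr_gt0.
  - by rewrite invfM mulrCA ger_pMr ?invr_gt0// ler_pdivrMr// mul1r lerDr mulr_ge0.
  - rewrite (mulrC K) mulrAC ltr_pdivrMr// (ltr_pM2l c_gt0).
    rewrite (@lt_le_trans _ _ (2 * K + c))// ?ltrDl//.
    by rewrite ler_peMl ?ler1n// ltW.
have t_lt1 : t < 1 by rewrite (le_lt_trans t1)// invf_lt1// ltr1n.
have tn : `|t| < 1 by rewrite gtr0_norm.
have := a0 (exist _ t tn : disc); rewrite /=.
set s := series _ => s0.
have key N : t ^+ n * c - `|s (N + n.+1)%N| <= t ^+ n.+1 * K / (1 - t).
  have -> : t ^+ n * c = `|t ^+ n *: a n|.
    by rewrite normrZ ger0_norm// exprn_ge0// ltW.
  rewrite lerBlDl.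
  have -> : s (N + n.+1)%N =
      t ^+ n *: a n + \sum_(n.+1 <= k < N + n.+1) t ^+ k *: a k.
    rewrite /s /series/= (@big_cat_nat _ _ _ n)//=; last by rewrite addnS leqW ?leq_addl.
    rewrite big1_seq ?add0r; last first.
      by move=> k /andP[_]; rewrite mem_index_iota => /andP[_ kn]; rewrite IH ?scaler0.
    by rewrite big_ltn// addnS ltnS leq_addl.
  set u := t ^+ n *: a n; set v := \sum_(_ <= _ < _) _.
  have -> : `|u| = `|(u + v) - v| by rewrite addrK.
  apply: (le_trans (ler_normB _ _)); rewrite lerD2l.
  apply: (le_trans (ler_norm_sum _ _ _)).
  apply: le_trans (geometric_le n.+1 (N + n.+1) _ K0); last by rewrite t_lt1 ltW.
  apply: ler_sum => k _; rewrite normrZ normrX (gtr0_norm t0).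
  by rewrite ler_wpM2l// exprn_ge0// ltW.
have s0' : `|s (N + n.+1)%N| @[N --> \oo] --> (0 : C).
  exact: cvg_shift_norm0.
have lim : t ^+ n * c <= t ^+ n.+1 * K / (1 - t).
  exact: (limC_leB s0' key).
have E : t ^+ n.+1 * K / (1 - t) = t ^+ n * (t * (K / (1 - t))).
  by rewrite exprSr !mulrA.
move: lim; rewrite E (ler_pM2l (exprn_gt0 n t0)) => lim.
suff /(le_lt_trans lim) : t * (K / (1 - t)) < c by rewrite ltxx.
apply: le_lt_trans tc; rewrite (ler_pM2l t0).
apply: ler_wpM2l => //; rewrite -[leRHS]invrK.
rewrite lef_pV2 ?posrE ?invr_gt0 ?subr_gt0//.
by rewrite lerBrDr -lerBrDl (le_trans t1)// [X in X - _](splitr 1) mul1r addrK.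
Qed.

Lemma power_sumZD (c : C) a b f g : power_sum a f -> power_sum b g ->
  power_sum (fun m => c *: a m + b m) (c *: f + g).
Proof.
move=> af bg z.
have -> : series (fun m => val z ^+ m *: (c *: a m + b m)) =
  c *: series (fun m => val z ^+ m *: a m) + series (fun m => val z ^+ m *: b m).
  apply/funext => n; rewrite /series/= !fctE scaler_sumr -big_split/=.
  by apply: eq_bigr => m _; rewrite scalerDr !scalerA mulrC.
exact: (cvgD (cvgZr (af z)) (bg z)).
Qed.

End hardy_coefficients.
Arguments disc : clear implicits.

Section hardy_space.
Context {R : realType} {D : hilbertType R}.
Local Notation C := (Cplx R).

Definition hardy_pred : {pred disc R -> D} :=
  fun f => `[< exists2 a, square_summable a & power_sum a f >].

(* H^2_D: the functions f(z) = \sum_m z^m a_m on the open unit disc with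
   \sum_m |a_m|^2 finite. *)
Record hardy := Hardy { hardy_fun :> disc R -> D ; _ : hardy_fun \in hardy_pred }.

HB.instance Definition _ := [isSub for hardy_fun].
HB.instance Definition _ := [Choice of hardy by <:].

Lemma hardy_submod_closed : submod_closed hardy_pred.
Proof.
split.
  apply/asboolP; exists (fun=> 0).
    apply: (@square_summable_le _ _ _ 0) => n.
    by rewrite big1// => m _; rewrite normr0 expr0n.
  move=> z; rewrite (_ : series _ = fun=> 0); first exact: cvg_cst.
  by apply/funext => n; rewrite /series/= big1// => m _; rewrite scaler0.
move=> c f g /asboolP[a a2 af] /asboolP[b b2 bg].
apply/asboolP; exists (fun m => c *: a m + b m).
- exact: square_summableZD.
- exact: power_sumZD.
Qed.

HB.instance Definition _ :=
  GRing.isSubmodClosed.Build C (disc R -> D) hardy_pred hardy_submod_closed.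
HB.instance Definition _ := [SubChoice_isSubLmodule of hardy by <:].

Lemma hardy_has_coef (f : hardy) :
  exists2 a : nat -> D, square_summable a & power_sum a f.
Proof. by case: f => f /= /asboolP. Qed.

(* the Taylor coefficients at 0, unique by [hardy_coefE] *)
Definition hardy_coef (f : hardy) : nat -> D := sval (cid2 (hardy_has_coef f)).

Lemma hardy_coef_square_summable f : square_summable (hardy_coef f).
Proof. by rewrite /hardy_coef; case: cid2. Qed.
Arguments hardy_coef_square_summable : clear implicits.

Lemma hardy_coef_power_sum f : power_sum (hardy_coef f) f.
Proof. by rewrite /hardy_coef; case: cid2. Qed.
Arguments hardy_coef_power_sum : clear implicits.

Lemma hardy_coefE (f : hardy) a :
  square_summable a -> power_sum a f -> hardy_coef f = a.
Proof.
move=> a2 af.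
have := power_sum0 (square_summableZD (c := -1) a2 (hardy_coef_square_summable f)).
have := power_sumZD (c := -1) af (hardy_coef_power_sum f).
rewrite scaleN1r addNr => h /(_ h) E.
by apply/funext => m; have := E m; rewrite scaleN1r => /eqP; rewrite addrC subr_eq0 => /eqP.
Qed.

Lemma hardy_coefZD c (f g : hardy) m :
  hardy_coef (c *: f + g) m = c *: hardy_coef f m + hardy_coef g m.
Proof.
rewrite (@hardy_coefE _ (fun m => c *: hardy_coef f m + hardy_coef g m))//.
  by apply: square_summableZD; exact: hardy_coef_square_summable.
exact: (power_sumZD (c := c) (hardy_coef_power_sum f) (hardy_coef_power_sum g)).
Qed.

Lemma hardy_of_coef a : square_summable a -> exists f, hardy_coef f = a.
Proof.
move=> a2; have [f af] := power_sum_cvg a2.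
have fP : f \in hardy_pred by apply/asboolP; exists a.
by exists (Hardy fP); exact: hardy_coefE.
Qed.

Lemma hardy_coef0 m : hardy_coef 0 m = 0.
Proof.
have := hardy_coefZD (-1) 0 0 m.
by rewrite !scaleN1r addNr => ->; rewrite addNr.
Qed.

Lemma hardy_coef_inj (f g : hardy) : hardy_coef f = hardy_coef g -> f = g.
Proof.
move=> fg; apply/val_inj/funext => z /=.
have := hardy_coef_power_sum f z; rewrite fg => h.
exact: (cvg_unique _ h (hardy_coef_power_sum g z)).
Qed.

Definition hardy_dot (f g : hardy) : C :=
  limn (series (fun m => '[hardy_coef f m, hardy_coef g m])).

Lemma hardy_dot_cvg f g :
  series (fun m => '[hardy_coef f m, hardy_coef g m]) @ \oo --> hardy_dot f g.
Proof.
pose a := hardy_coef f; pose b := hardy_coef g.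
have q (c : C) : cvgn (series (fun m => `|c *: b m + a m| ^+ 2 : C)).
  exact: (square_summableZD (hardy_coef_square_summable g)
                            (hardy_coef_square_summable f)).
apply: is_cvgC.
have -> : (fun m => '[hardy_coef f m, hardy_coef g m]) =
  (fun m => 4^-1 * `|1 *: b m + a m| ^+ 2 + (- 4^-1 * `|-1 *: b m + a m| ^+ 2 +
    ('i / 4 * `|'i *: b m + a m| ^+ 2 + (- ('i / 4) * `|- 'i *: b m + a m| ^+ 2 + 0)))).
  by apply/funext => m; rewrite !hdot_norm; exact: dot_polarization.
do 4![apply: is_cvg_seriesZD; first exact: q].
by rewrite series0C; exact: is_cvg_cst.
Qed.
Arguments hardy_dot_cvg : clear implicits.

Lemma hardy_dot_linearl (h : hardy) c f g :
  hardy_dot (c *: f + g) h = c * hardy_dot f h + hardy_dot g h.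
Proof.
apply: (cvg_uniqueC (hardy_dot_cvg _ _)).
apply: (eq_cvg_seriesC _ (cvg_seriesZD (hardy_dot_cvg f h) (hardy_dot_cvg g h))) => m.
by rewrite hardy_coefZD linearDl linearZl_LR.
Qed.

Lemma hardy_dot_herm f g : hardy_dot f g = (-1) ^+ false * (hardy_dot g f)^*.
Proof.
rewrite expr0 mul1r; apply: (cvg_uniqueC (hardy_dot_cvg _ _)).
apply: (eq_cvg_seriesC _ (cvg_series_conj (hardy_dot_cvg g f))) => m.
by rewrite (hermC _ (hardy_coef f m)) expr0 mul1r.
Qed.

Lemma hardy_dot_linearr (h : hardy) :
  GRing.linear_for (@Num.conj C \; *%R) (hardy_dot h).
Proof.
move=> c f g /=; rewrite hardy_dot_herm hardy_dot_linearl expr0 mul1r.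
by rewrite rmorphD rmorphM/= (hardy_dot_herm h f) (hardy_dot_herm h g) !expr0 !mul1r.
Qed.

HB.instance Definition _ := bilinear_isBilinear.Build C hardy hardy C
  *%R (@Num.conj C \; *%R) hardy_dot
  (hardy_dot_linearl, hardy_dot_linearr).
HB.instance Definition _ := isHermitianSesquilinear.Build C hardy false
  (@Num.conj C) hardy_dot hardy_dot_herm.

Lemma hardy_dot_ge (f : hardy) n :
  \sum_(0 <= m < n) `|hardy_coef f m| ^+ 2 <= hardy_dot f f.
Proof.
have := nneg_seriesC_le _ (hardy_dot_cvg f f) n; rewrite /series/=.
under eq_bigr do rewrite -hdot_norm.
by apply=> m; rewrite -hdot_norm exprn_ge0.
Qed.

Lemma hardy_dot_gt0 (f : hardy) : f != 0 -> 0 < hardy_dot f f.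
Proof.
move=> f0; have [m fm] : exists m, hardy_coef f m != 0.
  apply/not_existsP => fm0; move/eqP: f0; apply.
  apply: hardy_coef_inj; apply/funext => m; rewrite hardy_coef0.
  by apply/eqP/negP => /negP; exact: fm0.
apply: lt_le_trans (hardy_dot_ge f m.+1).
rewrite big_nat_recr//= ltr_wpDl ?sumr_ge0// ?exprn_gt0 ?normr_gt0// sumr_ge0.
Qed.

HB.instance Definition _ := isDotProduct.Build C hardy hardy_dot hardy_dot_gt0.

Lemma hardy_dot_le (f : hardy) (M : C) :
  (forall n, \sum_(0 <= m < n) `|hardy_coef f m| ^+ 2 <= M) -> hardy_dot f f <= M.
Proof.
move=> fM; apply: (limC_le (hardy_dot_cvg f f)) => n.
by rewrite /series/=; under eq_bigr do rewrite -hdot_norm; exact: fM.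
Qed.

Definition hardy_norm (f : hardy) : C := sqrtC (hardy_dot f f).

Lemma hardy_normD f g : hardy_norm (f + g) <= hardy_norm f + hardy_norm g.
Proof. exact: dot_triangle. Qed.

Lemma hardy_normZ (c : C) f : hardy_norm (c *: f) = `|c| * hardy_norm f.
Proof.
rewrite /hardy_norm linearZl_LR linearZr_LR/= mulrA -normCK.
by rewrite sqrtCM ?nnegrE ?exprn_ge0 ?dot_ge0// sqrCK.
Qed.

Lemma hardy_norm_eq0 f : hardy_norm f = 0 -> f = 0.
Proof.
move/eqP; rewrite sqrtC_eq0 => /eqP f0; apply/eqP/negP => /negP/hardy_dot_gt0.
by rewrite f0 ltxx.
Qed.

HB.instance Definition _ :=
  Lmodule_isNormed.Build C hardy hardy_normD hardy_normZ hardy_norm_eq0.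

Lemma hardy_normE (f : hardy) : `|f| ^+ 2 = hardy_dot f f.
Proof. exact: sqrtCK. Qed.

End hardy_space.
Arguments hardy {R} D.
Arguments hardy_coef_square_summable {R D} f.
Arguments hardy_coef_power_sum {R D} f z.

Section hardy_hilbert.
Context {R : realType} (D : hilbertType R).
Local Notation C := (Cplx R).
Local Notation hardy := (hardy D).

Lemma hardy_coef_le (f : hardy) m : `|hardy_coef f m| <= `|f|.
Proof.
rewrite -(@ler_pXn2r _ 2) ?nnegrE// hardy_normE.
by apply: le_trans (hardy_dot_ge f m.+1); rewrite big_nat_recr//= lerDr sumr_ge0.
Qed.

Lemma hardy_coefB (f g : hardy) m :
  hardy_coef (f - g) m = hardy_coef f m - hardy_coef g m.
Proof. by rewrite addrC -scaleN1r hardy_coefZD scaleN1r addrC. Qed.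

Lemma hardy_complete (F : set_system hardy) :
  ProperFilter F -> cauchy F -> cvg F.
Proof.
move=> FF Fc.
have coef_cvg m : cvg (hardy_coef^~ m @ F).
  apply/cauchy_cvgP/cauchy_exP => e e0.
  have /cauchyP/(_ e e0)[f Ff] := Fc.
  exists (hardy_coef f m); rewrite /nbhs/=; apply: filterS Ff => g.
  rewrite -!ball_normE/= => fg; apply: le_lt_trans fg.
  by rewrite -hardy_coefB hardy_coef_le.
pose a m := lim (hardy_coef^~ m @ F).
have close e : 0 < e -> \forall f \near F, forall n,
    \sum_(0 <= m < n) `|hardy_coef f m - a m| ^+ 2 <= e ^+ 2.
  move=> e0.
  have /nearP_dep : \forall f & g \near F, ball f e g.
    by move/cauchy_ballP : Fc => /(_ e e0).
  apply: filterS => f fF n.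
  apply: (limF_le (F := F)
    (u := fun g => \sum_(0 <= m < n) `|hardy_coef f m - hardy_coef g m| ^+ 2)).
    apply: (@cvg_sum_sqnorm C _ F _ D (fun m g => hardy_coef f m - hardy_coef g m)).
    by move=> m; apply: cvgB; [exact: cvg_cst|exact: coef_cvg].
  apply: filterS fF => g; rewrite -ball_normE/= => /ltW fg.
  apply: (@le_trans _ _ (`|f - g| ^+ 2)); last first.
    by rewrite ler_pXn2r ?nnegrE ?normr_ge0// ltW.
  rewrite hardy_normE; apply: le_trans (hardy_dot_ge (f - g) n).
  by apply: ler_sum => m _; rewrite hardy_coefB.
have [f0 f0a] := filter_ex (close 1 ltr01).
have a2 : square_summable a.
  have -> : a = fun m => -1 *: (hardy_coef f0 m - a m) + hardy_coef f0 m.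
    by apply/funext => m; rewrite scaleN1r opprB subrK.
  apply: square_summableZD (square_summable_le f0a) _.
  exact: hardy_coef_square_summable.
have [h ha] := hardy_of_coef a2.
apply/cvg_ex; exists h; apply/cvgrPdist_le => e e0.
apply: filterS (close e e0) => f fa.
rewrite distrC -(@ler_pXn2r _ 2) ?nnegrE ?(ltW e0)// hardy_normE.
apply: hardy_dot_le => n.
by apply: le_trans (fa n); apply: ler_sum => m _; rewrite hardy_coefB ha.
Qed.

HB.instance Definition _ := Uniform_isComplete.Build hardy hardy_complete.

HB.instance Definition _ :=
  isHilbert.Build R hardy (@hardy_normE R D).

Lemma hardy_shift_subproof (f : hardy) :
  (fun z : disc R => val z *: f z) \in @hardy_pred R D.
Proof.
apply/asboolP.
exists (fun m => if m is k.+1 then hardy_coef f k else 0).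
  have [M fM] := square_summable_ex_le (hardy_coef_square_summable f).
  apply: (@square_summable_le _ _ _ M) => -[|n].
    by have := fM 0%N; rewrite !big_nil.
  by rewrite big_nat_recl//= normr0 expr0n add0r; exact: fM.
move=> z; rewrite -cvg_shiftS.
have zf : val z *: series (fun m => val z ^+ m *: hardy_coef f m) @ \oo -->
    val z *: f z by exact: cvgZr (hardy_coef_power_sum f z).
apply: cvg_trans zf; apply: near_eq_cvg; apply: nearW => n.
rewrite /series/= big_nat_recl//= scaler0 add0r !fctE scaler_sumr.
by apply: eq_bigr => m _; rewrite scalerA -exprS.
Qed.

(* (M_z f)(z) = z f(z) *)
Definition Mz (f : hardy) : hardy := Hardy (hardy_shift_subproof f).

End hardy_hilbert.

(* Main.v *)
(* Write A' for the adjoint of A and P for P_S. If P = Pi Pi', then Pi' kills the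
   complement of S, so ran Pi lies in S; hence T s = T Pi Pi' s = Pi M_z Pi' s
   lies in S for s in S.

   Conversely, if S is invariant, then TP = PTP, so T P T' <= P and P - T P T'
   has a self-adjoint square root E. The map V x = \sum_n z^n E T'^n x satisfies
   V T' = M_z' V, and <V x, V y> = \sum_n <(P - T P T') T'^n x, T'^n y> telescopes
   to <P x, y> because T'^n -> 0 strongly; so Pi = V' works, with D = H instead
   of the closure of ran E. *)

From HB Require Import structures.
Require Import Defs.
From mathcomp Require Import all_boot all_order all_algebra.
From mathcomp Require Import all_classical all_reals all_analysis.
From mathcomp Require Import complex ring.

Set Implicit Arguments.
Unset Strict Implicit.
Unset Printing Implicit Defensive.

Import Order.TTheory GRing.Theory Num.Theory.
Import numFieldNormedType.Exports.

Local Open Scope classical_set_scope.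
Local Open Scope ring_scope.

(** * Limits under Lipschitz bounds, and calculus of the inner product *)

Lemma cvg_lipschitz (C : numFieldType) (V W : normedModType C) (k : C)
    (u : nat -> V) (l : V) (w : nat -> W) (a : W) :
  (forall n, `|w n - a| <= k * `|u n - l|) -> u @ \oo --> l -> w @ \oo --> a.
Proof.
move=> wu ul; apply/cvgrPdist_lt => e e0.
(* [k] may vanish and has no prescribed sign, hence the divisor [|k| + 1]. *)
have k0 : 0 < `|k| + 1 by rewrite ltr_wpDl.
have ke0 : 0 < e / (`|k| + 1) by rewrite divr_gt0.
move/cvgrPdist_lt : ul => /(_ _ ke0); apply: filterS => n.
rewrite ltr_pdivlMr// => h; rewrite distrC; apply: le_lt_trans h.
apply: (@le_trans _ _ (`|k| * `|u n - l|)).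
  have kr : k * `|u n - l| \is Num.real by apply: ger0_real; exact: le_trans (wu n).
  apply: le_trans (wu n) _; apply: le_trans (real_ler_norm kr) _.
  by rewrite normrM normr_id.
by rewrite mulrC distrC ler_wpM2l// lerDl.
Qed.

Section inner_product.
Context {R : realType} {H : hilbertType R}.
Local Notation C := (Cplx R).
Implicit Types (x y z : H) (c : C).

Lemma hdotDl x y z : '[x + y, z] = '[x, z] + '[y, z].
Proof. exact: linearDl. Qed.

Lemma hdotBl x y z : '[x - y, z] = '[x, z] - '[y, z].
Proof. exact: linearBl. Qed.

Lemma hdotZl c x z : '[c *: x, z] = c * '[x, z].
Proof. by rewrite linearZl_LR. Qed.

Lemma hdotDr x y z : '[z, x + y] = '[z, x] + '[z, y].
Proof. exact: linearDr. Qed.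

Lemma hdotBr x y z : '[z, x - y] = '[z, x] - '[z, y].
Proof. exact: linearBr. Qed.

Lemma hdotZr c x z : '[z, c *: x] = c^* * '[z, x].
Proof. by rewrite linearZr_LR. Qed.

Lemma hdotC x y : '[x, y] = '[y, x]^*.
Proof. by rewrite hermC expr0 mul1r. Qed.

Lemma hdot0l x : '[0, x] = 0.
Proof. exact: linear0l. Qed.

Lemma hdot_eq0 x : '[x, x] = 0 -> x = 0.
Proof.
by rewrite -hdot_norm => /eqP; rewrite expf_eq0/= normr_eq0 => /eqP.
Qed.

Lemma hdot_inj x y : (forall z, '[x, z] = '[y, z]) -> x = y.
Proof.
move=> xy; apply/eqP; rewrite -subr_eq0; apply/eqP/hdot_eq0.
by rewrite hdotBl xy subrr.
Qed.

Lemma norm_hdot_le x y : `|'[x, y]| <= `|x| * `|y|.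
Proof.
apply: le_trans (dot_CauchySchwarz _ _ _) _.
by rewrite -!hdot_norm !sqrCK// lexx.
Qed.

Lemma cvg_hdotl (u : nat -> H) x y :
  u @ \oo --> x -> (fun n => '[u n, y]) @ \oo --> '[x, y].
Proof.
apply: (cvg_lipschitz (k := `|y|)) => n.
by rewrite -hdotBl mulrC norm_hdot_le.
Qed.

Lemma cvg_hdotr (u : nat -> H) x y :
  u @ \oo --> x -> (fun n => '[y, u n]) @ \oo --> '[y, x].
Proof.
by apply: (cvg_lipschitz (k := `|y|)) => n; rewrite -hdotBr norm_hdot_le.
Qed.

Lemma cvg_hdot_self (u : nat -> H) x :
  u @ \oo --> x -> (fun n => '[u n, u n]) @ \oo --> '[x, x].
Proof.
move=> ux; rewrite -hdot_norm expr2.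
rewrite (_ : (fun n => _) = (fun n => `|u n| * `|u n|)); last first.
  by apply/funext => n; rewrite -hdot_norm expr2.
by apply: cvgM; exact: cvg_norm.
Qed.

End inner_product.

(** * Riesz representation on a closed subspace *)

Section riesz.
Context {R : realType} {H : hilbertType R}.
Local Notation C := (Cplx R).

Lemma geometric_series_le2 n : \sum_(0 <= k < n) (2^-1 : C) ^+ k <= 2.
Proof.
have h : 0 <= (2^-1 : C) < 1 by rewrite invr_ge0 ler0n invf_lt1// ltr1n.
have := geometric_le 0 n h ler01; under eq_bigr do rewrite mulr1.
move=> /le_trans; apply; rewrite expr0 mulr1 mul1r [X in X - _](splitr 1) mul1r addrK.
by rewrite invrK.
Qed.

Lemma is_cvg_series_half (M : C) : 0 <= M ->
  cvgn (series (fun n => M * (2^-1 : C) ^+ n)).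
Proof.
move=> M0; apply: (nneg_seriesC_cvg (M := M * 2)) => [n|n].
  by rewrite mulr_ge0// exprn_ge0// invr_ge0 ler0n.
by rewrite /series/= -mulr_sumr ler_wpM2l// geometric_series_le2.
Qed.

(* The minimiser over S of |s|^2 - 2 Re (phi s) represents phi; any minimising
   sequence is Cauchy by the parallelogram law. *)
Lemma riesz_subspace (S : set H) (phi : {scalar H}) (M : C) :
  closed_subspace S -> 0 <= M -> (forall s, S s -> `|phi s| <= M * `|s|) ->
  exists2 z, S z & forall s, S s -> phi s = '[s, z].
Proof.
move=> [[S0 Slin] clS] M0 phiM.
have {S0}S0 : S 0 by move: S0; rewrite inE.
have {}Slin c s t : S s -> S t -> S (c *: s + t).
  by move=> Ss St; have := Slin c s t; rewrite !inE; exact.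
have SD s t : S s -> S t -> S (s + t) by rewrite -[s in s + t]scale1r; exact: Slin.
have SZ c s : S s -> S (c *: s) by rewrite -[_ *: _]addr0 => Ss; exact: Slin.
(* The functional to minimise takes real values inside [C]; its copy [J] in [R] makes infima
   available. *)
pose K s : C := '[s, s] - (phi s + (phi s)^*).
pose J s : R := complex.Re (K s).
have KJ s : K s = real_complex R (J s).
  rewrite /J RRe_real// rpredB//.
    by apply: ger0_real; exact: dot_ge0.
  by rewrite CrealE rmorphD/= conjCK addrC.
have phiZ c s : phi (c *: s) = c * phi s by rewrite linearZ.
have KD s t c : K (s + c *: t) = K s + c * c^* * '[t, t]
    - (c * (phi t - '[t, s]) + (c * (phi t - '[t, s]))^*).
  rewrite /K (linearD phi) phiZ !(hdotDl, hdotDr, hdotZl, hdotZr).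
  rewrite (hdotC s t) !(rmorphD, rmorphM, rmorphB)/=.
  ring.
(* Parallelogram law: the contributions of [phi] cancel, leaving the squared distance. *)
have par s t : '[s - t, s - t] = 2 * K s + 2 * K t - 4 * K (2^-1 *: (s + t)).
  rewrite /K phiZ (linearD phi) !(hdotBl, hdotBr, hdotZl, hdotZr, hdotDl, hdotDr).
  rewrite !(rmorphD, rmorphM)/= fmorphV/= rmorph_nat.
  by field.
(* Since 2 Re (phi s) <= 2 M |s|, completing the square bounds [K s] below by -M^2. *)
have Jlb s : S s -> - complex.Re (M ^+ 2) <= J s.
  move=> Ss; rewrite -lecR -KJ rmorphN/= RRe_real ?ger0_real ?exprn_ge0//.
  rewrite /K -hdot_norm lerBrDr addrC lerBlDr.
  have -> : phi s + (phi s)^* = 'Re (phi s) *+ 2.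
    by rewrite -mulr_natr ReE divfK// pnatr_eq0.
  apply: (@le_trans _ _ ((M * `|s|) *+ 2)).
    by rewrite lerMn2r/=; apply: le_trans (phiM _ Ss); exact: (leif_Re_Creal _).1.
  rewrite -subr_ge0 (_ : _ - _ = (`|s| - M) ^+ 2); last by rewrite sqrrB; ring.
  by rewrite -realEsqr realB// ger0_real.
have [m Jm minm] : exists2 m : R, (forall s, S s -> m <= J s) &
    forall e, 0 < e -> exists2 s, S s & J s < m + e.
  pose E := J @` S.
  have Einf : has_inf E.
    split; first by exists (J 0), 0.
    by exists (- complex.Re (M ^+ 2)) => _ [s Ss <-]; exact: Jlb.
  exists (inf E) => [s Ss|e /inf_adherent/(_ Einf)[_ [s Ss <-]]]; last by exists s.
  by apply: ge_inf; [case: Einf|exists s].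
pose mC : C := real_complex R m.
have mK s : S s -> mC <= K s by move=> Ss; rewrite KJ lecR Jm.
(* Through [par], the margin 4^-n makes consecutive distances at most 2 * 2^-n, which is
   summable. *)
have /choice[s sP] : forall n, exists s, S s /\ K s <= mC + 4^-1 ^+ n.
  move=> n; have [|s Ss sm] := minm (4^-1 ^+ n); first by rewrite exprn_gt0.
  exists s; split=> //; rewrite KJ /mC.
  rewrite (_ : 4^-1 ^+ n = real_complex R (4^-1 ^+ n)); last first.
    by rewrite rmorphXn fmorphV rmorph_nat.
  by rewrite -rmorphD lecR ltW.
have ds n : `|s n.+1 - s n| <= 2 * 2^-1 ^+ n.
  rewrite -(@ler_pXn2r _ 2)// ?nnegrE ?mulr_ge0 ?exprn_ge0 ?invr_ge0 ?ler0n//.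
  rewrite hdot_norm par.
  have [Sn Kn] := sP n; have [Sn1 Kn1] := sP n.+1.
  have Kmid := mK _ (SZ 2^-1 _ (SD _ _ Sn1 Sn)).
  apply: (@le_trans _ _ (2 * (mC + 4^-1 ^+ n) + 2 * (mC + 4^-1 ^+ n) - 4 * mC)).
    apply: lerB; last by rewrite ler_wpM2l.
    apply: lerD; rewrite ler_wpM2l//; apply: le_trans Kn1 _; rewrite lerD2l.
    rewrite exprS ler_piMl ?exprn_ge0 ?invr_ge0 ?ler0n// invf_le1//.
    by rewrite ler1n.
  rewrite exprMn exprAC (_ : 2^-1 ^+ 2 = 4^-1 :> C); last by field.
  by rewrite le_eqVlt; apply/orP; left; apply/eqP; ring.
have /cvg_ex[l sl] := normed_seriesC_cvg ds (is_cvg_series_half (ler0n _ 2)).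
pose z := s 0%N + l.
have sz : s @ \oo --> z.
  rewrite (_ : s = fun n => s 0%N + series (fun n => s n.+1 - s n) n).
    by apply: cvgD => //; exact: cvg_cst.
  by apply/funext => n; rewrite /series/= telescope_sumr// addrC subrK.
have Sz : S z by apply: (closed_cvg _ clS _ _ sz); apply: nearW => n; case: (sP n).
exists z => // t St.
have phiz : phi \o s @ \oo --> phi z.
  apply: (cvg_lipschitz (k := M) _ sz) => n /=.
  by rewrite -(linearB phi) phiM// addrC -scaleN1r; apply: Slin => //; case: (sP n).
have Kz : K z <= mC.
  have Ks : K \o s @ \oo --> K z.
    apply: cvgB; first exact: cvg_hdot_self.
    apply: (cvgD phiz); apply: (cvg_lipschitz (k := 1) _ phiz) => n /=.
    by rewrite mul1r -rmorphB norm_conjC.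
  have e0 : (fun n => 4^-1 ^+ n : C) @ \oo --> (0 : C).
    have h0 := cvg_series_cvg_0 (is_cvg_series_half ler01).
    rewrite -[X in _ --> X](mulr0 0) (_ : (fun n => _) =
      (fun n => (1 * 2^-1 ^+ n) * (1 * 2^-1 ^+ n) : C)); last first.
      apply/funext => n; rewrite !mul1r -exprMn; congr (_ ^+ _).
      by field.
    exact: cvgM.
  rewrite -[K z]subr0; apply: (limC_le (cvgB Ks e0)) => n.
  by rewrite !fctE lerBlDr; case: (sP n).
set w := phi t - '[t, z].
have [/eqP|w0] := eqVneq w 0; first by rewrite subr_eq0 => /eqP.
have d0 : 0 < 1 + '[t, t] by rewrite ltr_wpDr// dot_ge0.
(* Moving from [z] along [t] by this [c] lowers [K] by |w|^2 (2 + <t,t>) / (1 + <t,t>)^2, so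
   minimality forces w = 0. The added 1 keeps the denominator nonzero when t = 0. *)
pose c := w^* / (1 + '[t, t]).
have : K z <= K (z + c *: t).
  by apply: le_trans Kz (mK _ _); apply: SD => //; exact: SZ.
rewrite KD -/w.
have dr : (1 + '[t, t])^* = 1 + '[t, t] by rewrite (CrealP _)// ger0_real// ltW.
have Dne0 : 1 + '[t, t] != 0 by rewrite gt_eqF.
rewrite -addrA lerDl /c !(rmorphM, fmorphV)/= dr conjCK.
have -> : w^* / (1 + '[t, t]) * (w / (1 + '[t, t])) * '[t, t] -
    (w^* / (1 + '[t, t]) * w + w / (1 + '[t, t]) * w^*) =
    - ((w * w^*) / (1 + '[t, t]) ^+ 2 * (2 + '[t, t])).
  by field.
rewrite oppr_ge0 -normCK pmulr_lle0; last by rewrite ltr_wpDr// dot_ge0.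
rewrite pmulr_lle0 ?invr_gt0 ?exprn_gt0//.
by rewrite lt_geF// exprn_gt0// normr_gt0.
Qed.
End riesz.

(** * Existence of adjoints and of orthogonal projections *)

Section adjoint.
Context {R : realType}.
Local Notation C := (Cplx R).

(** Adjointness as a relation between bare functions: it can be used before [adjoint] is known to
    meet its specification, and it already forces linearity. *)
Definition adjoint_pair (H K : hilbertType R) (A : H -> K) (B : K -> H) :=
  forall x y, '[A x, y] = '[x, B y].

Lemma adjoint_pair_sym (H K : hilbertType R) (A : H -> K) (B : K -> H) :
  adjoint_pair A B -> adjoint_pair B A.
Proof. by move=> AB y x; rewrite hdotC -AB -hdotC. Qed.

Lemma adjoint_pair_linear (H K : hilbertType R) (A : H -> K) (B : K -> H) :
  adjoint_pair A B -> linear A.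
Proof.
move=> AB c x y; apply: hdot_inj => z.
by rewrite AB hdotDl hdotZl hdotDl hdotZl !AB.
Qed.

Lemma adjoint_pair_eq (H K : hilbertType R) (A : H -> K) (B : K -> H) :
  adjoint_pair A B -> adjoint A = B.
Proof.
move=> AB; apply/funext => y; rewrite /adjoint; case: xgetP => [z _ zP|/(_ (B y))].
  by apply: hdot_inj => x; rewrite hdotC -zP AB -hdotC.
by case=> x; exact: AB.
Qed.

(** Riesz on the whole space, applied for each [y] to the functional sending [x] to <A x, y>. *)
Lemma adjointP (H K : hilbertType R) (A : {linear H -> K}) :
  bounded_op A -> adjoint_pair A (adjoint A).
Proof.
move=> [M AM].
suff /choice[B AB] : forall y, exists z, forall x, '[A x, y] = '[x, z].
  have AB' : adjoint_pair A B by move=> x y; exact: AB.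
  by rewrite (adjoint_pair_eq AB').
move=> y.
have phi_lin : scalar (fun x => '[A x, y]).
  by move=> c u v; rewrite linearP hdotDl hdotZl.
pose phi : {scalar H} := HB.pack (fun x => '[A x, y])
  (GRing.isLinear.Build _ _ _ _ _ phi_lin).
have [||s _|z _ zP] := @riesz_subspace R H setT phi (`|M| * `|y|).
- by split; [split=> [|c u v _ _]; rewrite inE|exact: closedT].
- by rewrite mulr_ge0.
- apply: le_trans (norm_hdot_le _ _) _; rewrite mulrAC ler_wpM2r//.
  have Mr : M * `|s| \is Num.real by apply: ger0_real; exact: le_trans (AM s).
  apply: le_trans (AM s) _; apply: le_trans (real_ler_norm Mr) _.
  by rewrite normrM normr_id.
- by exists z => x; exact: zP.
Qed.

(** Riesz on [S] for the functional sending [s] to <s, x>: its representative z in [S] satisfies <s,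
    x - z> = 0 for all s in [S]. *)
Lemma orthoprojP (H : hilbertType R) (S : set H) (x : H) : closed_subspace S ->
  S (orthoproj S x) /\ forall s, S s -> '[x - orthoproj S x, s] = 0.
Proof.
move=> clS.
suff [z Sz zP] : exists2 z, S z & forall s, S s -> '[x - z, s] = 0.
  by rewrite /orthoproj; case: xgetP => [//|/(_ z)]; case.
have phi_lin : scalar (fun s => '[s, x]).
  by move=> c u v; rewrite hdotDl hdotZl.
pose phi : {scalar H} := HB.pack (fun s => '[s, x])
  (GRing.isLinear.Build _ _ _ _ _ phi_lin).
have [|s Ss|z Sz zP] := @riesz_subspace R H S phi `|x| clS.
- exact: normr_ge0.
- by rewrite mulrC norm_hdot_le.
- exists z => // s Ss; rewrite hdotC hdotBr.
  by have /= -> := zP _ Ss; rewrite subrr conjC0.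
Qed.

End adjoint.

(** * Square root of 1 - X for a self-adjoint contraction X *)

Section operator_sqrt.
Context {R : realType} {H : hilbertType R}.
Local Notation C := (Cplx R).
Variable X : H -> H.
Hypothesis X_sym : adjoint_pair X X.
Hypothesis X_le : forall x, `|X x| <= `|x|.

Fixpoint sqrt_iter n (x : H) : H :=
  if n is k.+1 then 2^-1 *: (X x + sqrt_iter k (sqrt_iter k x)) else 0.

(* The iteration for X = 1, whose increments dominate those of [sqrt_iter]. *)
Fixpoint sqrt_bound n : C :=
  if n is k.+1 then 2^-1 * (1 + sqrt_bound k ^+ 2) else 0.

Lemma sqrt_iter_sym n : adjoint_pair (sqrt_iter n) (sqrt_iter n).
Proof.
elim: n => [|n IH] x y /=; first by rewrite hdot0l hdotC hdot0l conjC0.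
by rewrite hdotZl hdotZr hdotDl hdotDr X_sym !IH fmorphV rmorph_nat.
Qed.

Lemma sqrt_iterZD n c x y :
  sqrt_iter n (c *: x + y) = c *: sqrt_iter n x + sqrt_iter n y.
Proof. exact: (adjoint_pair_linear (sqrt_iter_sym n)). Qed.

Lemma sqrt_iterB n x y : sqrt_iter n (x - y) = sqrt_iter n x - sqrt_iter n y.
Proof. by rewrite addrC -scaleN1r sqrt_iterZD scaleN1r addrC. Qed.

(** Each iterate is a polynomial in [X], so it commutes with every linear map that commutes with
    [X], in particular with the other iterates. *)
Lemma sqrt_iter_comm (Z : H -> H) n : linear Z ->
  (forall x, Z (X x) = X (Z x)) ->
  forall x, Z (sqrt_iter n x) = sqrt_iter n (Z x).
Proof.
move=> Zlin ZX; elim: n => [|n IH] x /=.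
  by have := Zlin (-1) 0 0; rewrite scaler0 addr0 scaleN1r addNr.
have Z0 : Z 0 = 0 by have := Zlin (-1) 0 0; rewrite scaler0 addr0 scaleN1r addNr.
have ZZ c u : Z (c *: u) = c *: Z u by rewrite -[_ *: u]addr0 Zlin Z0 addr0.
have ZD u v : Z (u + v) = Z u + Z v by rewrite -[u in LHS]scale1r Zlin scale1r.
by rewrite ZZ ZD ZX !IH.
Qed.

Lemma sqrt_iter_comm2 n m x :
  sqrt_iter n (sqrt_iter m x) = sqrt_iter m (sqrt_iter n x).
Proof.
apply: sqrt_iter_comm => [|y]; first exact: sqrt_iterZD.
by rewrite -(sqrt_iter_comm _ (adjoint_pair_linear X_sym)).
Qed.

Lemma sqrt_bound_ge0 n : 0 <= sqrt_bound n.
Proof.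
by elim: n => //= n IH; rewrite mulr_ge0 ?invr_ge0 ?ler0n// addr_ge0 ?exprn_ge0.
Qed.

Lemma sqrt_bound_le1 n : sqrt_bound n <= 1.
Proof.
elim: n => //= n IH.
rewrite ler_pdivrMl ?ltr0n// mulr1 -[leRHS]/(1 + 1) lerD2l.
by rewrite exprn_ile1// sqrt_bound_ge0.
Qed.

Lemma sqrt_iter_le n x : `|sqrt_iter n x| <= sqrt_bound n * `|x|.
Proof.
elim: n x => [|n IH] x /=; first by rewrite normr0 mul0r.
rewrite normrZ ger0_norm ?invr_ge0 ?ler0n// -mulrA ler_wpM2l ?invr_ge0 ?ler0n//.
apply: le_trans (ler_normD _ _) _; rewrite mulrDl mul1r lerD//.
apply: le_trans (IH _) _; rewrite expr2 -mulrA ler_wpM2l ?sqrt_bound_ge0//.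
Qed.

Lemma sqrt_iter_le1 n x : `|sqrt_iter n x| <= `|x|.
Proof.
apply: le_trans (sqrt_iter_le n x) _.
by rewrite ler_piMl// sqrt_bound_le1.
Qed.

Lemma sqrt_iterS n x :
  sqrt_iter n.+1 x = 2^-1 *: (X x + sqrt_iter n (sqrt_iter n x)).
Proof. by []. Qed.

Lemma sqrt_boundS n : sqrt_bound n.+1 = 2^-1 * (1 + sqrt_bound n ^+ 2).
Proof. by []. Qed.

(** As the iterates commute, Y_(n+2) - Y_(n+1) = (Y_(n+1) + Y_n)(Y_(n+1) - Y_n) / 2. The scalar
    iteration factors in the same way, so the domination passes from n to n + 1. *)
Lemma sqrt_iter_step n x : `|sqrt_iter n.+1 x - sqrt_iter n x| <=
  (sqrt_bound n.+1 - sqrt_bound n) * `|x|.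
Proof.
elim: n x => [|n IH] x; first by rewrite !subr0; exact: sqrt_iter_le.
set d := sqrt_iter n.+1 x - sqrt_iter n x.
have -> : sqrt_iter n.+2 x - sqrt_iter n.+1 x =
    2^-1 *: (sqrt_iter n.+1 d + sqrt_iter n d).
  rewrite (sqrt_iterS n.+1) [X in _ - X = _]sqrt_iterS.
  rewrite -scalerBr /d !sqrt_iterB (sqrt_iter_comm2 n n.+1); congr (_ *: _).
  by rewrite addrA subrK opprD addrACA subrr add0r.
rewrite normrZ ger0_norm ?invr_ge0 ?ler0n//.
have -> : sqrt_bound n.+2 - sqrt_bound n.+1 =
    2^-1 * ((sqrt_bound n.+1 + sqrt_bound n) * (sqrt_bound n.+1 - sqrt_bound n)).
  by rewrite (sqrt_boundS n.+1) [X in _ - X = _]sqrt_boundS; ring.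
rewrite -mulrA ler_wpM2l ?invr_ge0 ?ler0n//.
apply: (@le_trans _ _ ((sqrt_bound n.+1 + sqrt_bound n) * `|d|)).
  by rewrite mulrDl; apply: le_trans (ler_normD _ _) _; rewrite lerD ?sqrt_iter_le.
by rewrite -mulrA; apply: ler_wpM2l (IH x); rewrite addr_ge0 ?sqrt_bound_ge0.
Qed.

(** The increments of [sqrt_bound] telescope to at most 1, so those of [sqrt_iter] are absolutely
    summable at each vector. *)
Lemma sqrt_iter_cvg x : cvgn (sqrt_iter^~ x).
Proof.
have tele n : series (fun n => sqrt_iter n.+1 x - sqrt_iter n x) n = sqrt_iter n x.
  by rewrite /series/= telescope_sumr// subr0.
rewrite (_ : sqrt_iter^~ x = series (fun n => sqrt_iter n.+1 x - sqrt_iter n x)).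
  2: by apply/funext => n; rewrite tele.
apply: (normed_seriesC_cvg (b := fun n => (sqrt_bound n.+1 - sqrt_bound n) * `|x|)).
  by move=> n; exact: sqrt_iter_step.
apply: (nneg_seriesC_cvg (M := `|x|)) => n.
  by apply: le_trans (sqrt_iter_step n x).
rewrite /series/= -mulr_suml telescope_sumr// subr0.
by rewrite ler_piMl// sqrt_bound_le1.
Qed.

(* The limit Y of the iteration Y_(n+1) = (X + Y_n^2)/2 satisfies
   (1 - Y)^2 = 1 - X. *)
Lemma operator_sqrt : exists2 E : H -> H, adjoint_pair E E &
  forall x, E (E x) = x - X x.
Proof.
pose Y x := limn (sqrt_iter^~ x).
have YP x : sqrt_iter^~ x @ \oo --> Y x by exact: sqrt_iter_cvg.
have Y_sym : adjoint_pair Y Y.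
  move=> x y; have h1 := cvg_hdotl (y := y) (YP x).
  have h2 := cvg_hdotr (y := x) (YP y).
  have E : (fun n => '[sqrt_iter n x, y]) = (fun n => '[x, sqrt_iter n y]).
    by apply/funext => n; rewrite sqrt_iter_sym.
  by rewrite E in h1; exact: (cvg_uniqueC h1 h2).
have YY x : Y x = 2^-1 *: (X x + Y (Y x)).
  have h : (fun n => sqrt_iter n.+1 x) @ \oo --> 2^-1 *: (X x + Y (Y x)).
    apply: cvgZr; apply: cvgD; first exact: cvg_cst.
    (* Outer and inner iterates both vary with n; the contraction bound, uniform in n, lets the
       inner one be replaced by its limit. *)
    have h0 : (fun n => sqrt_iter n (sqrt_iter n x) - sqrt_iter n (Y x)) @ \oo --> (0 : H).
      apply: (cvg_lipschitz (k := 1) _ (YP x)) => n.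
      by rewrite subr0 mul1r -sqrt_iterB sqrt_iter_le1.
    have h1 := cvgD h0 (YP (Y x)); rewrite add0r in h1.
    rewrite (_ : (fun n => _) = (fun n => sqrt_iter n (sqrt_iter n x) -
      sqrt_iter n (Y x)) + sqrt_iter^~ (Y x)); first exact: h1.
    by apply/funext => n; rewrite !fctE subrK.
  have h' : (fun n => sqrt_iter n.+1 x) @ \oo --> Y x.
    by rewrite (cvg_shiftS (sqrt_iter^~ x)); exact: YP.
  exact: (cvg_unique _ h' h).
exists (fun x => x - Y x) => [x y|x].
  by rewrite hdotBl hdotBr Y_sym.
have YB u v : Y (u - v) = Y u - Y v.
  by rewrite addrC -scaleN1r (adjoint_pair_linear Y_sym) scaleN1r addrC.
have Y2 : X x = 2 *: Y x - Y (Y x).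
  by rewrite [in 2 *: _]YY scalerA mulfV ?pnatr_eq0// scale1r addrK.
rewrite Y2 YB scaler_nat mulr2n !opprB.
by rewrite addrACA -opprD -addrA.
Qed.
End operator_sqrt.

(** * Norm estimates through the inner product; orthogonal projections *)

Lemma ler_norm_hdot (R : realType) (H K : hilbertType R) (x : H) (y : K) :
  (`|x| <= `|y|) = ('[x, x] <= '[y, y]).
Proof. by rewrite -!hdot_norm ler_pXn2r ?nnegrE ?normr_ge0. Qed.

(** Cancels a norm, possibly zero, in an estimate of the form |u|^2 <= |u| c. *)
Lemma ler_sqr_mul (C : numFieldType) (x c : C) :
  0 <= x -> 0 <= c -> x ^+ 2 <= x * c -> x <= c.
Proof.
by rewrite le0r => /orP[/eqP->//|x0] _; rewrite expr2 ler_pM2l.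
Qed.

(** From |A x|^2 = <x, B A x> <= |x| |B A x| <= |x| |A x|, cancel |A x|. *)
Lemma adjoint_pair_contraction (R : realType) (H K : hilbertType R)
    (A : H -> K) (B : K -> H) :
  adjoint_pair A B -> (forall y, `|B y| <= `|y|) -> forall x, `|A x| <= `|x|.
Proof.
move=> AB B_le x; apply: ler_sqr_mul => //.
rewrite -[leLHS]ger0_norm ?exprn_ge0// hdot_norm AB.
by apply: le_trans (norm_hdot_le _ _) _; rewrite mulrC ler_wpM2r.
Qed.

Section orthogonal_projection.
Context {R : realType} {H : hilbertType R} (S : set H).
Hypothesis clS : closed_subspace S.
Local Notation P := (orthoproj S).

Lemma orthoproj_mem x : S (P x).
Proof. exact: (orthoprojP x clS).1. Qed.

Lemma orthoproj_orthol x s : S s -> '[x - P x, s] = 0.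
Proof. exact: (orthoprojP x clS).2. Qed.

Lemma orthoproj_orthor x s : S s -> '[s, x - P x] = 0.
Proof. by move=> Ss; rewrite hdotC orthoproj_orthol// conjC0. Qed.

Lemma closed_subspaceB s t : S s -> S t -> S (s - t).
Proof.
move: clS => [[_ Slin] _] Ss St; have := Slin (-1) t s.
by rewrite !inE scaleN1r addrC; exact.
Qed.

Lemma orthoproj_id s : S s -> P s = s.
Proof.
move=> Ss; have := orthoproj_orthol s (closed_subspaceB Ss (orthoproj_mem s)).
by move=> /hdot_eq0/eqP; rewrite subr_eq0 => /eqP.
Qed.

Lemma orthoproj_dotl x s : S s -> '[P x, s] = '[x, s].
Proof.
by move=> /(orthoproj_orthol x)/eqP; rewrite hdotBl subr_eq0 => /eqP.
Qed.

(** Both inner products equal <P x, P y>. *)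
Lemma orthoproj_sym : adjoint_pair P P.
Proof.
move=> x y; rewrite -(orthoproj_dotl x (orthoproj_mem y)).
by rewrite hdotC -(orthoproj_dotl _ (orthoproj_mem x)) -hdotC.
Qed.

Lemma orthoproj_idem_dot x y : '[P x, P y] = '[P x, y].
Proof. by rewrite orthoproj_sym (orthoproj_id (orthoproj_mem y)) -orthoproj_sym. Qed.

Lemma orthoproj_pythagoras x : '[x, x] = '[x - P x, x - P x] + '[P x, P x].
Proof.
rewrite -hnormDd ?subrK//; apply: orthoproj_orthol; exact: orthoproj_mem.
Qed.

Lemma orthoproj_le x : `|P x| <= `|x|.
Proof.
rewrite ler_norm_hdot [leRHS]orthoproj_pythagoras lerDr.
exact: dot_ge0.
Qed.

End orthogonal_projection.

(** * The shift in terms of Taylor coefficients *)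

Lemma hardy_coef_Mz (R : realType) (D : hilbertType R) (f : hardy D) :
  hardy_coef (Mz f) = fun m => if m is k.+1 then hardy_coef f k else 0.
Proof.
apply: hardy_coefE => [|z].
  have [M fM] := square_summable_ex_le (hardy_coef_square_summable f).
  apply: (@square_summable_le _ _ _ M) => -[|n].
    by have := fM 0%N; rewrite !big_nil.
  by rewrite big_nat_recl//= normr0 expr0n add0r; exact: fM.
(* The constant term is 0, so partial sum n + 1 of the shifted series is z times partial sum n of
   the original one. *)
rewrite -cvg_shiftS.
rewrite (_ : (fun n => _) = val z *: series (fun m => val z ^+ m *: hardy_coef f m)).
  exact: cvgZr (hardy_coef_power_sum f z).
apply/funext => n; rewrite /series/= big_nat_recl//= scaler0 add0r !fctE scaler_sumr.
by apply: eq_bigr => m _; rewrite scalerA -exprS.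
Qed.

(** * From an invariant subspace to a factorization *)

Section invariant_to_factorization.
Context {R : realType} {H : hilbertType R}.
Local Notation C := (Cplx R).
Variables (T Ts : H -> H) (S : set H).
Hypothesis clS : closed_subspace S.
Hypothesis TTs : adjoint_pair T Ts.
Hypothesis T_le : forall x, `|T x| <= `|x|.
Hypothesis Ts_cvg0 : forall x, (fun m => iter m Ts x) @ \oo --> (0 : H).
Hypothesis TS : T @` S `<=` S.
Local Notation P := (orthoproj S).

(** Invariance of [S] enters the construction directly only here. *)
Let TPTs_mem x : S (T (P (Ts x))).
Proof. by apply: TS; exists (P (Ts x)) => //; exact: orthoproj_mem. Qed.

Let TPTs_sym : adjoint_pair (fun x => T (P (Ts x))) (fun x => T (P (Ts x))).
Proof.
by move=> x y; rewrite TTs (orthoproj_sym clS) (adjoint_pair_sym TTs).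
Qed.

(** As T P T' x lies in [S], |P T' x|^2 = <T P T' x, P x>; Cauchy-Schwarz and contractivity of [T]
    conclude. This is T P T' <= P in terms of norms. *)
Let PTs_le x : `|P (Ts x)| <= `|P x|.
Proof.
have E : `|P (Ts x)| ^+ 2 = '[T (P (Ts x)), P x].
  rewrite hdot_norm orthoproj_idem_dot// -TTs.
  by rewrite hdotC -(orthoproj_dotl clS _ (TPTs_mem x)) -hdotC.
apply: ler_sqr_mul => //; rewrite -[leLHS]ger0_norm ?exprn_ge0// E.
by apply: le_trans (norm_hdot_le _ _) _; rewrite ler_wpM2r.
Qed.

(** [operator_sqrt] is applied to X = (1 - P) + T P T', for which 1 - X = P - T P T'. The second
    summand maps into [S] and the first into its complement, so Pythagoras and [PTs_le] make X a
    contraction. *)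
Lemma defect_sqrt : exists2 E : H -> H, adjoint_pair E E &
  forall x, E (E x) = P x - T (P (Ts x)).
Proof.
pose X x := (x - P x) + T (P (Ts x)).
have [x y|x|E Esym EE] := @operator_sqrt R H X.
- by rewrite /X hdotDl hdotDr TPTs_sym hdotBl hdotBr (orthoproj_sym clS).
- rewrite ler_norm_hdot.
  rewrite hnormDd; last exact: orthoproj_orthol.
  rewrite [leRHS](orthoproj_pythagoras clS) lerD2l -ler_norm_hdot.
  by rewrite (le_trans (T_le _)).
- by exists E => // x; rewrite EE /X opprD opprB addrA [x + _]addrC subrK.
Qed.

Lemma invariant_factorization : exists Pi : {linear hardy H -> H},
  [/\ bounded_op Pi,
      forall f : hardy H, Pi (Mz f) = T (Pi f) &
      forall x : H, P x = Pi (adjoint Pi x)].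
Proof.
have [E Esym EE] := defect_sqrt.
(* By E^2 = P - T P T', each summand is the difference of <P T'^n x, T'^n y> at n and n + 1. *)
have tele x y N : \sum_(0 <= n < N) '[E (iter n Ts x), E (iter n Ts y)] =
    '[P x, y] - '[P (iter N Ts x), iter N Ts y].
  elim: N => [|N IH]; first by rewrite big_nil subrr.
  rewrite big_nat_recr//= IH -Esym EE hdotBl TTs -!iterS.
  by rewrite addrA subrK.
(* The bound <P x, x> is [tele] with y = x, where the subtracted term is a squared norm. *)
have /choice[V VE] : forall x, exists f : hardy H,
    hardy_coef f = fun n => E (iter n Ts x).
  move=> x; apply: hardy_of_coef; apply: (square_summable_le (M := '[P x, x])) => n.
  under eq_bigr do rewrite hdot_norm.
  by rewrite tele gerBl -orthoproj_idem_dot// dot_ge0.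
have iter_lin n c x y : iter n Ts (c *: x + y) = c *: iter n Ts x + iter n Ts y.
  elim: n => //= n ->; exact: (adjoint_pair_linear (adjoint_pair_sym TTs)).
have Vlin : linear V.
  move=> c x y; apply: hardy_coef_inj; apply/funext => n.
  by rewrite hardy_coefZD !VE iter_lin (adjoint_pair_linear Esym).
have VV x y : '[V x, V y] = '[P x, y].
  have h1 := @hardy_dot_cvg _ _ (V x) (V y).
  (* The factor in x tends to 0 by hypothesis; the factor in y only has to stay bounded, which
     follows by iterating [PTs_le]. *)
  have h2 : (fun N => '[P (iter N Ts x), iter N Ts y]) @ \oo --> (0 : C).
    apply: (cvg_lipschitz (k := `|y|) _ (Ts_cvg0 x)) => n.
    have PTs_iter_le z : `|P (iter n Ts z)| <= `|z|.
      apply: (@le_trans _ _ `|P z|); last exact: orthoproj_le.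
      by elim: n => //= n; apply: le_trans; exact: PTs_le.
    rewrite !subr0 -orthoproj_idem_dot//; apply: le_trans (norm_hdot_le _ _) _.
    by rewrite mulrC ler_pM// orthoproj_le.
  have h3 := cvgB (cvg_cst ('[P x, y] : C)) h2.
  rewrite subr0 in h3.
  apply: (cvg_uniqueC h1).
  rewrite (_ : series _ = fun N => '[P x, y] - '[P (iter N Ts x), iter N Ts y]).
    exact: h3.
  by apply/funext => N; rewrite /series/= -tele; apply: eq_bigr => n _; rewrite !VE.
pose V' : {linear H -> hardy H} := HB.pack V (GRing.isLinear.Build _ _ _ _ _ Vlin).
have V_le x : `|V x| <= `|x|.
  by rewrite ler_norm_hdot VV -orthoproj_idem_dot// -ler_norm_hdot orthoproj_le.
have Vbd : bounded_op V' by exists 1 => x; rewrite mul1r; exact: V_le.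
have VPi : adjoint_pair (adjoint V') V := adjoint_pair_sym (adjointP Vbd).
pose Pi : {linear hardy H -> H} := HB.pack (adjoint V')
  (GRing.isLinear.Build _ _ _ _ _ (adjoint_pair_linear VPi)).
exists Pi; split.
- exists 1 => f; rewrite mul1r; exact: (adjoint_pair_contraction VPi).
(* Tested against x, the claim reads <M_z f, V x> = <f, V T' x>. Coefficient 0 of M_z f vanishes and
   coefficient n + 1 of V x is coefficient n of V T' x, so the two series agree after one shift. *)
- move=> f; apply: hdot_inj => x; rewrite TTs VPi [RHS]VPi.
  have h1 := @hardy_dot_cvg _ _ (Mz f) (V x).
  have h2 := @hardy_dot_cvg _ _ f (V (Ts x)).
  apply: (cvg_uniqueC h1).
  rewrite -cvg_shiftS.
  rewrite (_ : (fun n => _) = series (fun m => '[hardy_coef f m, hardy_coef (V (Ts x)) m])).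
    exact: h2.
  apply/funext => n; rewrite /series/= big_nat_recl//= hardy_coef_Mz hdot0l add0r.
  by apply: eq_bigr => m _; rewrite !VE iterSr.
(* Here Pi' = V, so Pi Pi' = V' V, which is P by [VV]. *)
- move=> x; rewrite (adjoint_pair_eq VPi); apply: hdot_inj => y.
  by rewrite [RHS]VPi VV.
Qed.

End invariant_to_factorization.

(** * From a factorization to invariance *)

Lemma factorization_invariant (R : realType) (H D : hilbertType R)
    (T : H -> H) (S : set H) (Pi : {linear hardy D -> H}) :
  closed_subspace S -> bounded_op Pi ->
  (forall f : hardy D, Pi (Mz f) = T (Pi f)) ->
  (forall x : H, orthoproj S x = Pi (adjoint Pi x)) -> T @` S `<=` S.
Proof.
move=> clS /adjointP Piadj PiT PiP.
have PiS f : S (Pi f).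
  (* The part of Pi f orthogonal to [S] vanishes: |Pi' w|^2 = <P w, w> = 0, and then <w, w> = <Pi f,
     w> = <f, Pi' w> = 0. *)
  pose w := Pi f - orthoproj S (Pi f).
  have Pw : adjoint Pi w = 0.
    apply: hdot_eq0; rewrite -Piadj -PiP; apply: orthoproj_orthor => //.
    exact: orthoproj_mem.
  have : '[w, w] = 0.
    rewrite {1}/w hdotBl Piadj Pw (orthoproj_orthor clS)//; last exact: orthoproj_mem.
    by rewrite hdotC hdot0l conjC0 subrr.
  move=> /hdot_eq0/eqP; rewrite subr_eq0 => /eqP ->; exact: orthoproj_mem.
by move=> _ [s Ss <-]; rewrite -(orthoproj_id clS Ss) PiP -PiT; exact: PiS.
Qed.

Theorem corollary2p3 (R : realType) (H : hilbertType R)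
    (T : {linear H -> H}) (S : set H) :
  separable_space H -> bounded_op T -> C_dot0_contraction T ->
  closed_subspace S -> S <> [set 0] ->
  (T @` S `<=` S) <->
  (exists (D : hilbertType R) (Pi : {linear hardy D -> H}),
    [/\ separable_space D,
        bounded_op Pi,
        forall f : hardy D, Pi (Mz f) = T (Pi f) &
        forall x : H, orthoproj S x = Pi (adjoint Pi x)]).
Proof.
move=> sepH Tbd [T_le Ts_cvg0] clS _; split=> [TS|[D [Pi [_ Pibd PiT PiP]]]].
  have [Pi [Pibd PiT PiP]] :=
    invariant_factorization clS (adjointP Tbd) T_le Ts_cvg0 TS.
  (* With D = H, the separability required of D is the one assumed of [H]. *)
  by exists H, Pi.
exact: factorization_invariant clS Pibd PiT PiP.
Qed.
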